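(* Let $T$ be the graph with vertex set $\{x_1,\dots,x_7\}$ and edge set $\{x_1x_2,\ x_2x_3,\ x_3x_4,\ x_4x_5,\ x_3x_6,\ x_6x_7\}$ (the tree obtained from a claw by subdividing each edge once). Then $T$ is not a co-TT graph.
   Context: A graph $G=(V,E)$ is a threshold tolerance graph if each vertex $v$ can be assigned a positive weight $w_v$ and a positive tolerance $t_v$ such that for distinct $u,v$, $uv\in E$ iff $w_u+w_v>\min\{t_u,t_v\}$. A co-TT graph is the complement of a threshold tolerance graph. Equivalently (Monma–Reed–Trotter), $G$ is co-TT iff one can assign positive numbers $a_v,b_v$ to each vertex $v$ such that for distinct $x,y$: $xy\in E$ iff $a_x\le b_y$ and $a_y\le b_x$. *)

(* Defs.v *)
From HB Require Import structures.
From mathcomp Require Import all_boot all_order all_algebra.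
From mathcomp Require Import reals.

Set Implicit Arguments.
Unset Strict Implicit.
Unset Printing Implicit Defensive.

Import Order.TTheory GRing.Theory Num.Theory.

Local Open Scope ring_scope.

Record sgraph := SGraph {
  vertex :> finType;
  edge : rel vertex;
  edge_sym : symmetric edge;
  edge_irrefl : irreflexive edge }.

Section Complement.
Variable G : sgraph.

Definition compl_edge : rel G := [rel u v | (u != v) && ~~ edge u v].

Lemma compl_edge_sym : symmetric compl_edge.
Proof. by move=> u v; rewrite /compl_edge /= eq_sym edge_sym. Qed.

Lemma compl_edge_irrefl : irreflexive compl_edge.
Proof. by move=> u; rewrite /compl_edge /= eqxx. Qed.

Definition compl_graph : sgraph := SGraph compl_edge_sym compl_edge_irrefl.

End Complement.

Definition threshold_tolerance (R : realType) (G : sgraph) : Prop :=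
  exists w t : G -> R,
    [/\ forall v : G, 0 < w v,
        forall v : G, 0 < t v
      & forall u v : G, u != v ->
          (edge u v <-> Num.min (t u) (t v) < w u + w v)].

(* Since complementation is an involution, G is the complement of a threshold
   tolerance graph iff its own complement is a threshold tolerance graph. *)
Definition coTT (R : realType) (G : sgraph) : Prop :=
  threshold_tolerance R (compl_graph G).

Definition T_edges : seq (nat * nat) :=
  [:: (1, 2); (2, 3); (3, 4); (4, 5); (3, 6); (6, 7)]%N.

(* The vertex x_k, 1 <= k <= 7, is the ordinal of value k - 1. *)
Definition T_edge : rel 'I_7 :=
  [rel i j : 'I_7 | ((i.+1, j.+1) \in T_edges) || ((j.+1, i.+1) \in T_edges)].

Lemma T_edge_sym : symmetric T_edge.
Proof. by move=> i j; rewrite /T_edge /= orbC. Qed.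

Lemma T_edge_irrefl : irreflexive T_edge.
Proof. by case; do 7?case=> //. Qed.

Definition T : sgraph := SGraph T_edge_sym T_edge_irrefl.

(* Main.v *)
(** In a co-TT graph put [a = w] and [b = t - w], so that distinct [x], [y] are
    adjacent iff [a x <= b y] and [a y <= b x]; when [a <= b] this says that
    intervals meet, but [b x < a x] is possible.  Non-adjacency of [x] and [y]
    means [b x < a y] or [b y < a x], which orients every pair among the three
    pairwise non-adjacent vertices [x_2], [x_4], [x_6].  A tournament on three
    vertices contains a path [m -> m' -> m''], and the leaf [l] attached to [m']
    is then adjacent to the centre [c], since [a c <= b m < a m' <= b l] and
    [a l <= b m' < a m'' <= b c]. *)

Require Import Defs.
From mathcomp Require Import all_boot all_order all_algebra.
From mathcomp Require Import reals.

Import Order.TTheory GRing.Theory Num.Theory.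

Definition meets {d} {O : orderType d} {V : Type} (a b : V -> O) (u v : V) :=
  ((a u <= b v) && (a v <= b u))%O.

Lemma coTT_meets (R : realType) (G : sgraph) : coTT R G ->
  exists a b : G -> R, forall u v : G, u != v -> edge u v = meets a b u v.
Proof.
move=> [w [t [_ _ nonedgeE]]]; exists w, (fun v => t v - w v)%R => u v uv.
have complE : edge (s := compl_graph G) u v = ~~ edge u v.
  exact: (congr1 (andb^~ _) uv).
have {}nonedgeE : ~~ edge u v = (Num.min (t u) (t v) < w u + w v)%R.
  by rewrite -complE; apply/idP/idP => /(nonedgeE u v uv).
(* With [b = t - w], the bound [w u + w v <= t v] reads [w u <= b v], and symmetrically. *)
rewrite -[edge u v]negbK nonedgeE -leNgt le_min /meets andbC.
by rewrite !lerBrDr [(w v + w u)%R]addrC.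
Qed.

Section Meets.
Context {d : Order.disp_t} {O : orderType d} {V : Type} (a b : V -> O).
Implicit Types c m l : V.

Lemma meets_pendant_between c m m' m'' l :
    meets a b c m -> meets a b c m'' -> meets a b m' l ->
  (b m < a m')%O -> (b m' < a m'')%O -> meets a b c l.
Proof.
move=> /andP[cm _] /andP[_ m''c] /andP[m'l lm'] /ltW mm' /ltW m'm''.
by rewrite /meets (le_trans cm (le_trans mm' m'l))
  (le_trans lm' (le_trans m'm'' m''c)).
Qed.

Lemma not_meets_subdivided_claw c m1 m2 m3 l1 l2 l3 :
    meets a b c m1 -> meets a b c m2 -> meets a b c m3 ->
    meets a b m1 l1 -> meets a b m2 l2 -> meets a b m3 l3 ->
    ~~ meets a b c l1 -> ~~ meets a b c l2 -> ~~ meets a b c l3 ->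
    ~~ meets a b m1 m2 -> ~~ meets a b m2 m3 -> ~~ meets a b m1 m3 ->
  False.
Proof.
move=> c1 c2 c3 e1 e2 e3 /negP n1 /negP n2 /negP n3.
rewrite {1 2 3}/meets !negb_and -!ltNge.
(* In each of the eight cases some middle vertex of a directed path has a leaf contradicting [n1],
   [n2] or [n3]. *)
by move=> /orP[] h12 /orP[] h23 /orP[] h13;
  eauto 3 using meets_pendant_between.
Qed.

End Meets.

Theorem theorem14 (R : realType) : ~ coTT R T.
Proof.
move=> /coTT_meets[a [b edgeE]].
pose x k : T := inord k.
(* Numerals below 7 survive [inord], so adjacency in [T] becomes a computation. *)
have xE i j : (i < 7)%N -> (j < 7)%N -> i != j ->
    meets a b (x i) (x j) =
    (((i.+1, j.+1) \in T_edges) || ((j.+1, i.+1) \in T_edges)).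
  move=> i7 j7 ij; rewrite -edgeE; first by rewrite /= /T_edge /= !inordK.
  by apply: contra ij => /eqP/(congr1 (@nat_of_ord 7)); rewrite !inordK // => ->.
(* Indices are shifted by one: [x 2] is the centre $x_3$, followed by its neighbours and their
   leaves. *)
by apply: (not_meets_subdivided_claw a b
  (x 2) (x 1) (x 3) (x 5) (x 0) (x 4) (x 6)); rewrite xE.
Qed.
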